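(* Let $\mathbb{K}$ be a field and let $V$ be a vector space over $\mathbb{K}$ with finite positive dimension. Let $A,A^*$ be a tridiagonal pair on $V$, with eigenspaces of $A$ ordered as $V_0,V_1,\ldots,V_d$ and eigenspaces of $A^*$ ordered as $V^*_0,V^*_1,\ldots,V^*_d$ so as to satisfy conditions (ii) and (iii) in the definition of a tridiagonal pair. Let $\mathcal{D}$ denote the subalgebra of $\mathrm{End}(V)$ generated by $A$. Then the following (i), (ii) are equivalent. (i) There exists a nonzero $X\in\mathcal{D}$ such that $XV^*_0\subseteq V^*_d$. (ii) The pair $A,A^*$ is a Leonard pair.
   Context: $\mathrm{End}(V)$ denotes the $\mathbb{K}$-algebra of all $\mathbb{K}$-linear transformations from $V$ to $V$. For $A\in\mathrm{End}(V)$, a subspace $W\subseteq V$ is an eigenspace of $A$ whenever $W\neq 0$ and there exists $\theta\in\mathbb{K}$ such that $W=\{v\in V\mid Av=\theta v\}$. $A$ is diagonalizable whenever $V$ is spanned by the eigenspaces of $A$. A tridiagonal pair on $V$ is an ordered pair $A,A^*$ of elements of $\mathrm{End}(V)$ such that: (i) each of $A,A^*$ is diagonalizable; (ii) there exists an ordering $V_0,V_1,\ldots,V_d$ of the eigenspaces of $A$ (all of them, each listed once) such that $A^*V_i\subseteq V_{i-1}+V_i+V_{i+1}$ for $0\le i\le d$, where $V_{-1}=0$, $V_{d+1}=0$; (iii) there exists an ordering $V^*_0,V^*_1,\ldots,V^*_\delta$ of the eigenspaces of $A^*$ (all of them, each listed once) such that $AV^*_i\subseteq V^*_{i-1}+V^*_i+V^*_{i+1}$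 for $0\le i\le\delta$, where $V^*_{-1}=0$, $V^*_{\delta+1}=0$; (iv) there is no subspace $W$ of $V$ such that both $AW\subseteq W$ and $A^*W\subseteq W$, other than $W=0$ and $W=V$. Here $A^*$ is just a name for the second transformation (it is not the conjugate-transpose or adjoint of $A$). It is known that $d=\delta$ for every tridiagonal pair, and that $V_i$ and $V^*_i$ have the same dimension, denoted $\rho_i$, for $0\le i\le d$; the vector $(\rho_0,\rho_1,\ldots,\rho_d)$ is called the shape of $A,A^*$. A Leonard pair is a tridiagonal pair with shape $(1,1,\ldots,1)$, i.e. one for which all the eigenspaces $V_i$ and $V^*_i$ have dimension one. The subalgebra $\mathcal{D}$ generated by $A$ contains the identity $I$, i.e. it consists of all polynomials in $A$ with coefficients in $\mathbb{K}$. *)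

(* Defs.v *)
From HB Require Import structures.
From mathcomp Require Import all_boot all_order all_algebra.

Set Implicit Arguments.
Unset Strict Implicit.
Unset Printing Implicit Defensive.

Import GRing.Theory.

Local Open Scope ring_scope.

Definition is_eigenspace (K : fieldType) (V : vectType K)
    (A : 'End(V)) (W : {vspace V}) : Prop :=
  W != 0%VS /\ exists theta : K, forall v : V, (v \in W) = (A v == theta *: v).

(* V is finite-dimensional, so the span of the union of the eigenspaces is
   already the span of a finite sequence of vectors taken from them. *)
Definition diagonalizable_end (K : fieldType) (V : vectType K)
    (A : 'End(V)) : Prop :=
  exists s : seq V,
    (forall v, v \in s -> exists2 W, is_eigenspace A W & v \in W) /\
    <<s>>%VS = fullv.

Definition eigenspace_ordering (K : fieldType) (V : vectType K)
    (A : 'End(V)) (d : nat) (U : 'I_d.+1 -> {vspace V}) : Prop :=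
  injective U /\
  forall W : {vspace V}, is_eigenspace A W <-> exists i, W = U i.

(* The sum runs over the indices j in {i - 1, i, i + 1} lying in {0, ..., d};
   this is U_(i-1) + U_i + U_(i+1) with U_(-1) = U_(d+1) = 0. *)
Definition tridiagonal_action (K : fieldType) (V : vectType K)
    (B : 'End(V)) (d : nat) (U : 'I_d.+1 -> {vspace V}) : Prop :=
  forall i : 'I_d.+1,
    (B @: U i <= \sum_(j < d.+1 | (i <= j.+1)%N && (j <= i.+1)%N) U j)%VS.

Definition standard_ordering (K : fieldType) (V : vectType K)
    (A B : 'End(V)) (d : nat) (U : 'I_d.+1 -> {vspace V}) : Prop :=
  eigenspace_ordering A U /\ tridiagonal_action B U.

Definition irreducible_pair (K : fieldType) (V : vectType K)
    (A B : 'End(V)) : Prop :=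
  forall W : {vspace V},
    (A @: W <= W)%VS -> (B @: W <= W)%VS -> W = 0%VS \/ W = fullv.

Definition tridiagonal_pair (K : fieldType) (V : vectType K)
    (A Astar : 'End(V)) : Prop :=
  [/\ diagonalizable_end A /\ diagonalizable_end Astar,
      exists (d : nat) (U : 'I_d.+1 -> {vspace V}),
        standard_ordering A Astar U,
      exists (delta : nat) (U : 'I_delta.+1 -> {vspace V}),
        standard_ordering Astar A U
    & irreducible_pair A Astar].

(* The condition on dimensions says that the shape is (1, 1, ..., 1). *)
Definition leonard_pair (K : fieldType) (V : vectType K)
    (A Astar : 'End(V)) : Prop :=
  [/\ tridiagonal_pair A Astar,
      forall W : {vspace V}, is_eigenspace A W -> \dim W = 1%N
    & forall W : {vspace V}, is_eigenspace Astar W -> \dim W = 1%N].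

Definition is_subalgebra (K : fieldType) (V : vectType K)
    (S : {vspace 'End(V)}) : Prop :=
  (\1%VF : 'End(V)) \in S /\
  (forall X Y : 'End(V), X \in S -> Y \in S -> (X \o Y)%VF \in S).

(* Membership in the intersection of all unital subalgebras of End(V) that
   contain A. *)
Definition in_generated_subalgebra (K : fieldType) (V : vectType K)
    (A X : 'End(V)) : Prop :=
  forall S : {vspace 'End(V)}, is_subalgebra S -> A \in S -> X \in S.

(* Main.v *)
Require Import Defs.
From mathcomp Require Import all_boot all_order all_algebra.
From mathcomp Require Import zify.

Set Implicit Arguments.
Unset Strict Implicit.
Unset Printing Implicit Defensive.

Import GRing.Theory.

Local Open Scope ring_scope.

(** Let [P_n = (A - theta_0) ... (A - theta_(n-1))] and let [v] be a nonzero
    vector of [Ustar_0]. Irreducibility forces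
    [(Ustar_0 + ... + Ustar_(n-1)) :&: (U_n + ... + U_d) = 0], and this makes
    [P_0 v, ..., P_d v] a basis of [T = D v] adapted to the flag
    [Ustar_0 + ... + Ustar_(n-1)]. If [X] in [D] is nonzero and maps [Ustar_0]
    to [Ustar_d], then [X v] is a nonzero vector of [T] in [Ustar_d], and the
    same argument with the reversed ordering shows that [T] is also adapted to
    the opposite flag. As [\dim T = d + 1], the two flags intersect in [T] in a
    nonzero vector of each [Ustar_i]; hence [T] is invariant under both maps,
    [T = V], and [\dim V = d + 1] is the number of eigenspaces. Conversely,
    when [\dim V = d + 1] we have [D v = V], which contains [Ustar_d]. *)

(** * Eigenspace decompositions of a single diagonalizable map *)

Definition shifted_prod (K : fieldType) (V : vectType K) (A : 'End(V))
    (s : seq K) : 'End(V) :=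
  foldl (fun f c => ((A - c *: \1) \o f)%VF) \1%VF s.

Lemma shifted_prod_rcons (K : fieldType) (V : vectType K) (A : 'End(V))
    (s : seq K) (c : K) (v : V) :
  shifted_prod A (rcons s c) v = A (shifted_prod A s v) - c *: shifted_prod A s v.
Proof.
by rewrite /shifted_prod foldl_rcons comp_lfunE /= add_lfunE opp_lfunE scale_lfunE id_lfunE.
Qed.

Lemma shifted_prod_eigen (K : fieldType) (V : vectType K) (A : 'End(V))
    (s : seq K) (c : K) (v : V) :
  A v = c *: v -> shifted_prod A s v = (\prod_(b <- s) (c - b)) *: v.
Proof.
move=> Av; elim/last_ind: s => [|s b IHs].
  by rewrite big_nil scale1r /shifted_prod /= id_lfunE.
rewrite shifted_prod_rcons IHs linearZ /= Av big_rcons /=.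
by rewrite !scalerA -scalerBl mulrC -mulrBl; congr (_ *: _); rewrite mulrC.
Qed.

(** Naming the eigenvalues allows polynomials in [A] to be evaluated on eigenvectors; the last
    clause records diagonalizability. *)
Definition eigensystem (K : fieldType) (V : vectType K) (A : 'End(V)) (d : nat)
    (U : 'I_d.+1 -> {vspace V}) (theta : 'I_d.+1 -> K) : Prop :=
  [/\ injective theta, forall i v, (v \in U i) = (A v == theta i *: v),
      forall i, U i != 0%VS & (\sum_i U i)%VS = fullv].

Lemma eigensystem_of_ordering (K : fieldType) (V : vectType K) (A : 'End(V))
    (d : nat) (U : 'I_d.+1 -> {vspace V}) :
  diagonalizable_end A -> eigenspace_ordering A U ->
  exists theta, eigensystem A U theta.
Proof.
move=> [s [sE spans]] [injU UE].
have eigU i : is_eigenspace A (U i) by apply/UE; exists i.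
have /fin_all_exists [theta thetaE] i :
    exists c : K, forall v, (v \in U i) = (A v == c *: v).
  by case: (eigU i).
exists theta; split=> // [i j eqij | i |].
- by apply: injU; apply/vspaceP=> v; rewrite !thetaE eqij.
- by case: (eigU i).
apply/eqP; rewrite eqEsubv subvf /= -spans.
apply/span_subvP=> v /sE [W /UE [i ->] vU].
by rewrite memvE; apply: (sumv_sup i) => //; rewrite -memvE.
Qed.

(** Lagrange interpolation: the product of [A - theta j] over all [j] other than [i] kills every
    component except the [i]-th, on which it acts by a nonzero scalar. *)
Lemma eigensystem_directv (K : fieldType) (V : vectType K) (A : 'End(V))
    (d : nat) (U : 'I_d.+1 -> {vspace V}) (theta : 'I_d.+1 -> K) :
  eigensystem A U theta -> directv (\sum_i U i).
Proof.
move=> [inj UE _ _]; apply/directv_sum_independent=> us usU us0 i _.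
have /(congr1 (shifted_prod A [seq theta j | j <- enum (predC1 i)])) := us0.
rewrite linear0 linear_sum (bigD1 i) //= big1 ?addr0; last first.
  move=> j neji; have /eqP Auj : A (us j) == theta j *: us j by rewrite -UE usU.
  rewrite (shifted_prod_eigen _ Auj) big_map (bigD1_seq j) ?enum_uniq ?mem_enum //=.
  by rewrite subrr mul0r scale0r.
have /eqP Aui : A (us i) == theta i *: us i by rewrite -UE usU.
rewrite (shifted_prod_eigen _ Aui) => /eqP; rewrite scaler_eq0 => /orP[|/eqP//].
rewrite big_map prodf_seq_eq0 => /hasP [j]; rewrite mem_enum /= => neji.
by rewrite subr_eq0 => /eqP /inj eqij; rewrite inE eqij eqxx in neji.
Qed.

Lemma eigensystem_rev (K : fieldType) (V : vectType K) (A : 'End(V))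
    (d : nat) (U : 'I_d.+1 -> {vspace V}) (theta : 'I_d.+1 -> K) :
  eigensystem A U theta ->
  eigensystem A (U \o @rev_ord _) (theta \o @rev_ord _).
Proof.
move=> [inj UE Un0 Uf]; split=> [|i v|i|] /=; rewrite ?UE //.
  exact: inj_comp inj rev_ord_inj.
by rewrite -Uf [RHS](reindex_inj rev_ord_inj).
Qed.

Lemma tridiagonal_action_rev (K : fieldType) (V : vectType K) (B : 'End(V))
    (d : nat) (U : 'I_d.+1 -> {vspace V}) :
  tridiagonal_action B U -> tridiagonal_action B (U \o @rev_ord _).
Proof.
move=> tri i; apply: subv_trans (tri (rev_ord i)) _.
rewrite (reindex_inj rev_ord_inj) /=; apply/subv_sumP=> j /andP[ij ji].
apply: (sumv_sup j) => //; move: ij ji (ltn_ord i) (ltn_ord j). rewrite /=; lia.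
Qed.

Lemma shift_sub_sum (K : fieldType) (V : vectType K) (A : 'End(V))
    (d : nat) (U : 'I_d.+1 -> {vspace V}) (theta : 'I_d.+1 -> K)
    (k : 'I_d.+1) (P Q : pred 'I_d.+1) (v : V) :
  eigensystem A U theta -> (forall i, P i -> i != k -> Q i) ->
  v \in (\sum_(i | P i) U i)%VS ->
  A v - theta k *: v \in (\sum_(i | Q i) U i)%VS.
Proof.
move=> [_ UE _ _] PQ /memv_sumP [us usU ->].
rewrite linear_sum scaler_sumr -sumrB; apply: memv_suml => i Pi.
have Ui := usU i Pi; have /eqP Aui : A (us i) == theta i *: us i by rewrite -UE.
rewrite /= Aui -scalerBl; have [-> | /(PQ i Pi) Qi] := eqVneq i k.
  by rewrite subrr scale0r mem0v.
by apply: rpredZ; rewrite memvE; apply: (sumv_sup i); rewrite -?memvE.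
Qed.

Lemma tridiagonal_sub_sum (K : fieldType) (V : vectType K) (B : 'End(V))
    (d : nat) (U : 'I_d.+1 -> {vspace V}) (P Q : pred 'I_d.+1) (v : V) :
  tridiagonal_action B U ->
  (forall i j : 'I_d.+1, P i -> (i <= j.+1)%N -> (j <= i.+1)%N -> Q j) ->
  v \in (\sum_(i | P i) U i)%VS -> B v \in (\sum_(i | Q i) U i)%VS.
Proof.
move=> tri PQ /(memv_img B); apply/subvP; rewrite limg_sum.
apply/subv_sumP=> i Pi; apply: subv_trans (tri i) _.
apply/subv_sumP=> j /andP[ij ji]; apply: (sumv_sup j) => //.
exact: PQ Pi ij ji.
Qed.

(** * Pairs of ordered eigenspace decompositions and their reversals *)

Definition td_system (K : fieldType) (V : vectType K) (A B : 'End(V)) (d : nat)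
    (U Us : 'I_d.+1 -> {vspace V}) (theta thetas : 'I_d.+1 -> K) : Prop :=
  [/\ eigensystem A U theta, eigensystem B Us thetas,
      tridiagonal_action B U, tridiagonal_action A Us & irreducible_pair A B].

Lemma td_system_revl (K : fieldType) (V : vectType K) (A B : 'End(V)) (d : nat)
    (U Us : 'I_d.+1 -> {vspace V}) (theta thetas : 'I_d.+1 -> K) :
  td_system A B U Us theta thetas ->
  td_system A B (U \o @rev_ord _) Us (theta \o @rev_ord _) thetas.
Proof.
case=> ? ? ? ? ?; split=> //; [exact: eigensystem_rev|exact: tridiagonal_action_rev].
Qed.

Lemma td_system_revr (K : fieldType) (V : vectType K) (A B : 'End(V)) (d : nat)
    (U Us : 'I_d.+1 -> {vspace V}) (theta thetas : 'I_d.+1 -> K) :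
  td_system A B U Us theta thetas ->
  td_system A B U (Us \o @rev_ord _) theta (thetas \o @rev_ord _).
Proof.
case=> ? ? ? ? ?; split=> //; [exact: eigensystem_rev|exact: tridiagonal_action_rev].
Qed.

(** * Flags formed by partial sums of eigenspaces *)

Definition head_sum (K : fieldType) (V : vectType K) (d : nat)
    (U : 'I_d.+1 -> {vspace V}) (n : nat) : {vspace V} :=
  (\sum_(i < d.+1 | (i < n)%N) U i)%VS.

Definition tail_sum (K : fieldType) (V : vectType K) (d : nat)
    (U : 'I_d.+1 -> {vspace V}) (n : nat) : {vspace V} :=
  (\sum_(i < d.+1 | (n <= i)%N) U i)%VS.

Lemma sub_sumv_pred (K : fieldType) (V : vectType K) (I : finType)
    (U : I -> {vspace V}) (P Q : pred I) :
  (forall i, P i -> Q i) -> (\sum_(i | P i) U i <= \sum_(i | Q i) U i)%VS.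
Proof. by move=> PQ; apply/subv_sumP=> i /PQ Qi; apply: (sumv_sup i). Qed.

Lemma head_sumS (K : fieldType) (V : vectType K) (d : nat)
    (U : 'I_d.+1 -> {vspace V}) (m n : nat) :
  (m <= n)%N -> (head_sum U m <= head_sum U n)%VS.
Proof. by move=> mn; apply: sub_sumv_pred => i im; apply: leq_trans mn. Qed.

Lemma tail_sum_rev (K : fieldType) (V : vectType K) (d : nat)
    (U : 'I_d.+1 -> {vspace V}) (n : nat) :
  (n <= d.+1)%N -> tail_sum U n = head_sum (U \o @rev_ord _) (d.+1 - n).
Proof.
move=> nd; rewrite /tail_sum (reindex_inj rev_ord_inj) /=.
by apply: eq_bigl => i; have := ltn_ord i; rewrite /=; lia.
Qed.

Lemma head_tail_sum_cap (K : fieldType) (V : vectType K) (A : 'End(V)) (d : nat)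
    (U : 'I_d.+1 -> {vspace V}) (theta : 'I_d.+1 -> K) (n : nat) (v : V) :
  eigensystem A U theta -> v \in head_sum U n -> v \in tail_sum U n -> v = 0.
Proof.
move=> /eigensystem_directv /directv_sum_independent ind.
case/memv_sumP=> us usU vE /memv_sumP [ws wsU vE'].
(* The two expansions of [v] use disjoint sets of indices; glued with opposite signs they form a
   vanishing sum, so directness kills every term. *)
pose zs (i : 'I_d.+1) := if (i < n)%N then us i else - ws i.
have zs0 : forall i, true -> zs i = 0.
  apply: ind => [i _|].
    rewrite /zs; case: ltnP => [/usU //|/wsU]; exact: rpredNr.
  rewrite (bigID (fun i : 'I_d.+1 => i < n)%N) /=.
  rewrite (eq_bigr us); last by move=> i; rewrite /zs => ->.
  rewrite -vE (eq_big (fun i : 'I_d.+1 => n <= i)%N (fun i : 'I_d.+1 => - ws i)).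
  - by rewrite sumrN -vE' subrr.
  - by move=> i; rewrite -leqNgt.
  - by move=> i; rewrite /zs => /negPf ->.
rewrite vE; apply: big1 => i lt_in.
by have := zs0 i isT; rewrite /zs lt_in.
Qed.

Lemma head_sum_neq_fullv (K : fieldType) (V : vectType K) (A : 'End(V)) (d : nat)
    (U : 'I_d.+1 -> {vspace V}) (theta : 'I_d.+1 -> K) :
  eigensystem A U theta -> head_sum U d != fullv.
Proof.
move=> sysU; have [_ _ /(_ ord_max) Un0 _] := sysU.
apply: contraNneq Un0 => full; rewrite -subv0; apply/subvP=> v vU.
rewrite memv0; apply/eqP; apply: (head_tail_sum_cap (n := d) sysU).
  by rewrite full memvf.
by rewrite memvE; apply: (sumv_sup ord_max); rewrite -?memvE.
Qed.

(* The sum [W] of all these intersections is invariant under [A] and [B] and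
   is contained in [head_sum Us d], so it is [0] by irreducibility. *)
Lemma split_cap (K : fieldType) (V : vectType K) (A B : 'End(V)) (d : nat)
    (U Us : 'I_d.+1 -> {vspace V}) (theta thetas : 'I_d.+1 -> K) (n : nat) (v : V) :
  td_system A B U Us theta thetas -> (n <= d.+1)%N ->
  v \in head_sum Us n -> v \in tail_sum U n -> v = 0.
Proof.
move=> [sysU sysUs triB triA irr] nd vh vt.
(* The terms [m = 0] and [m = d.+1] are zero; including them lets the shifts of [m] by one below
   stay in range. *)
pose W := (\sum_(m < d.+2) (head_sum Us m :&: tail_sum U m))%VS.
have tail0 w : w \in tail_sum U d.+1 -> w = 0.
  rewrite /tail_sum big_pred0; last by move=> i; rewrite ltnNge -ltnS ltn_ord.
  by rewrite memv0 => /eqP.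
have inW m w : (m <= d.+1)%N -> w \in head_sum Us m -> w \in tail_sum U m -> w \in W.
  move=> md wh wt; rewrite memvE; apply: (sumv_sup (Ordinal (md : m < d.+2)%N)) => //.
  by rewrite -memvE memv_cap wh.
(* [A - theta_m] sends the [m]-th intersection into the next one: [A] raises the head by one step,
   and the shift removes [U_m] from the tail. *)
have AW : (A @: W <= W)%VS.
  rewrite limg_sum; apply/subv_sumP=> m _; apply/subvP=> _ /memv_imgP [w + ->].
  rewrite memv_cap => /andP[wh wt]; have [md|dm] := leqP m d; last first.
    have E : m = d.+1 :> nat by apply/eqP; rewrite eqn_leq -ltnS ltn_ord.
    by rewrite E in wt; rewrite (tail0 _ wt) linear0 mem0v.
  rewrite -(subrK (theta (inord m) *: w) (A w)) rpredD //; last first.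
    by apply: rpredZ; apply: inW wh wt; rewrite ltnW.
  apply: (inW m.+1) => //.
    apply: rpredB; last by apply: rpredZ; apply: subvP wh; apply: head_sumS.
    by apply: tridiagonal_sub_sum triA _ wh => i j im _ ji; apply: leq_ltn_trans ji _.
  apply: shift_sub_sum sysU _ wt => i mi ne.
  by rewrite ltn_neqAle mi andbT; apply: contraNneq ne => mE; apply/eqP/val_inj; rewrite /= inordK.
(* Dually, [B - thetas_m] sends the intersection of index [m.+1] into that of index [m]: the shift
   removes [Us_m] from the head, and [B] lowers the tail by one step. *)
have BW : (B @: W <= W)%VS.
  rewrite limg_sum; apply/subv_sumP=> -[[|m] md] _; apply/subvP=> _ /memv_imgP [w + ->] /=;
    rewrite memv_cap => /andP[wh wt].
    move: wh; rewrite /head_sum big_pred0 // memv0 => /eqP ->.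
    by rewrite linear0 mem0v.
  rewrite -(subrK (thetas (inord m) *: w) (B w)) rpredD //; last first.
    by apply: rpredZ; apply: inW wh wt.
  apply: (inW m); first exact: ltnW.
    apply: shift_sub_sum sysUs _ wh => i mi ne.
    by rewrite ltn_neqAle -ltnS mi andbT; apply: contraNneq ne => mE; apply/eqP/val_inj; rewrite /= -mE inord_val.
  apply: rpredB; last by apply: rpredZ; apply: subvP wt; apply: sub_sumv_pred => i; apply: ltnW.
  by apply: tridiagonal_sub_sum triB _ wt => i j im ij _; rewrite -ltnS (leq_trans im).
have Wd : (W <= head_sum Us d)%VS.
  apply/subv_sumP=> m _; apply/subvP=> w; rewrite memv_cap => /andP[wh wt].
  have [md|dm] := leqP m d; first by apply: subvP wh; apply: head_sumS.
  have E : m = d.+1 :> nat by apply/eqP; rewrite eqn_leq -ltnS ltn_ord.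
  by rewrite E in wt; rewrite (tail0 _ wt) mem0v.
have := inW n v nd vh vt.
case: (irr W AW BW) => [-> | Wf]; first by rewrite memv0 => /eqP.
by have := head_sum_neq_fullv sysUs; rewrite eqEsubv subvf -Wf Wd.
Qed.

(** * Newton polynomials in [A] applied to a vector of [Us ord0] *)

(* The values [inord n] with [n > d] are junk; only indices [n <= d.+1] of the
   product matter. *)
Definition newton_op (K : fieldType) (V : vectType K) (A : 'End(V)) (d : nat)
    (theta : 'I_d.+1 -> K) (n : nat) : 'End(V) :=
  shifted_prod A (mkseq (theta \o inord) n).

Lemma newton_op0 (K : fieldType) (V : vectType K) (A : 'End(V)) (d : nat)
    (theta : 'I_d.+1 -> K) : newton_op A theta 0 = \1%VF.
Proof. by []. Qed.

Lemma newton_opS (K : fieldType) (V : vectType K) (A : 'End(V)) (d : nat)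
    (theta : 'I_d.+1 -> K) (n : nat) (v : V) :
  newton_op A theta n.+1 v =
  A (newton_op A theta n v) - theta (inord n) *: newton_op A theta n v.
Proof. by rewrite /newton_op mkseqS shifted_prod_rcons. Qed.

Lemma newton_op_eigen_eq0 (K : fieldType) (V : vectType K) (A : 'End(V)) (d : nat)
    (U : 'I_d.+1 -> {vspace V}) (theta : 'I_d.+1 -> K) (n : nat) (i : 'I_d.+1)
    (v : V) :
  eigensystem A U theta -> v \in U i -> (newton_op A theta n v == 0) = (i < n)%N || (v == 0).
Proof.
move=> [inj UE _ _]; rewrite UE => /eqP Av.
rewrite /newton_op (shifted_prod_eigen _ Av) scaler_eq0; congr (_ || _).
rewrite prodf_seq_eq0; apply/hasP/idP => [[c] | lt_in].
  case/mapP=> j; rewrite mem_iota /= add0n => jn -> /=.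
  rewrite subr_eq0 => /eqP /inj ->.
  (* For [j] above [d] the value [inord j] is arbitrary, but it is still at most [d], hence below
     [n]. *)
  have [jd | dj] := ltnP j d.+1; first by rewrite inordK.
  by apply: leq_trans (ltn_ord _) (leq_trans dj (ltnW jn)).
exists (theta i); last by rewrite /= subrr.
by apply/mapP; exists (i : nat); rewrite /= ?inord_val // mem_iota.
Qed.

(** All eigenvalues occur among the factors, so each eigenspace is killed, and the eigenspaces span
    [V]. *)
Lemma newton_op_full (K : fieldType) (V : vectType K) (A : 'End(V)) (d : nat)
    (U : 'I_d.+1 -> {vspace V}) (theta : 'I_d.+1 -> K) :
  eigensystem A U theta -> newton_op A theta d.+1 = 0.
Proof.
move=> sysU; have [_ _ _ Uf] := sysU; apply/lfunP=> v; rewrite zero_lfunE.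
have : v \in (\sum_i U i)%VS by rewrite Uf memvf.
case/memv_sumP=> us usU ->; rewrite linear_sum big1 // => i _.
by apply/eqP; rewrite (newton_op_eigen_eq0 _ sysU (usU i isT)) ltn_ord.
Qed.

Lemma newton_head (K : fieldType) (V : vectType K) (A B : 'End(V)) (d : nat)
    (U Us : 'I_d.+1 -> {vspace V}) (theta thetas : 'I_d.+1 -> K) (n : nat) (v : V) :
  td_system A B U Us theta thetas -> v \in Us ord0 ->
  newton_op A theta n v \in head_sum Us n.+1.
Proof.
move=> [_ _ _ triA _] vU; elim: n => [|n IHn].
  by rewrite id_lfunE memvE; apply: (sumv_sup ord0); rewrite -?memvE.
rewrite newton_opS; apply: rpredB; last first.
  by apply: rpredZ; apply: subvP IHn; apply: head_sumS.
by apply: tridiagonal_sub_sum triA _ IHn => i j lt_in _ ji; apply: leq_ltn_trans ji _.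
Qed.

Lemma newton_tail (K : fieldType) (V : vectType K) (A : 'End(V)) (d : nat)
    (U : 'I_d.+1 -> {vspace V}) (theta : 'I_d.+1 -> K) (n : nat) (v : V) :
  eigensystem A U theta -> (n <= d.+1)%N -> newton_op A theta n v \in tail_sum U n.
Proof.
move=> sysU; have [_ _ _ Uf] := sysU; elim: n => [_|n IHn nd].
  by rewrite id_lfunE /tail_sum Uf memvf.
rewrite newton_opS; apply: shift_sub_sum sysU _ (IHn (ltnW nd)) => i ni ne.
rewrite ltn_neqAle ni andbT; apply: contraNneq ne => nE.
by apply/eqP/val_inj; rewrite /= inordK.
Qed.

(** If [P_n v] fell one step short in the flag, then so would every later [P_m v]. In particular
    [P_d v] would lie in [head_sum Us d] and in [tail_sum U d], hence vanish by [split_cap]. Then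
    [v] would have no component in [U_d], which [split_cap] excludes once the order of [U] is
    reversed. *)
Lemma newton_notin_head (K : fieldType) (V : vectType K) (A B : 'End(V)) (d : nat)
    (U Us : 'I_d.+1 -> {vspace V}) (theta thetas : 'I_d.+1 -> K) (n : nat) (v : V) :
  td_system A B U Us theta thetas -> v \in Us ord0 -> v != 0 -> (n <= d)%N ->
  newton_op A theta n v \notin head_sum Us n.
Proof.
move=> sys vU vn0 nd; have [sysU _ _ triA _] := sys; have [_ _ _ Uf] := sysU.
apply: contra vn0 => inh; apply/eqP.
have up m : (n <= m)%N -> newton_op A theta m v \in head_sum Us m.
  elim: m => [|m IHm]; first by rewrite leqn0 => /eqP nE; rewrite nE in inh.
  rewrite leq_eqVlt => /orP[/eqP <- // | nm].
  have wm := IHm nm; rewrite newton_opS; apply: rpredB; last first.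
    by apply: rpredZ; apply: subvP wm; apply: head_sumS.
  by apply: tridiagonal_sub_sum triA _ wm => i j lt_in _ ji; apply: leq_ltn_trans ji _.
have w0 := split_cap sys (leqnSn d) (up d nd) (newton_tail v sysU (leqnSn d)).
(* It remains to see that [P_d v = 0] would put [v] in [U_0 + ... + U_(d-1)]. *)
apply: (split_cap (n := 1) (td_system_revl sys)) => //.
  by rewrite memvE; apply: (sumv_sup ord0); rewrite -?memvE.
have : v \in (\sum_i U i)%VS by rewrite Uf memvf.
case/memv_sumP=> us usU vE.
(* [P_d] kills [U_0], ..., [U_(d-1)] and is injective on [U_d], so [P_d v = 0] forces the last
   component to vanish. *)
have us_max : us ord_max = 0.
  move: w0; rewrite vE linear_sum (bigD1 ord_max) //= big1 ?addr0; last first.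
    move=> i ne; apply/eqP; rewrite (newton_op_eigen_eq0 _ sysU (usU i isT)).
    by rewrite ltn_neqAle -ltnS ltn_ord andbT -[d]/(val (@ord_max d)) (inj_eq val_inj) ne.
  by move/eqP; rewrite (newton_op_eigen_eq0 _ sysU (usU _ isT)) ltnn => /eqP.
rewrite vE (bigD1 ord_max) //= us_max add0r /tail_sum.
apply: memv_suml => i ne; rewrite memvE; apply: (sumv_sup (rev_ord i)).
  by rewrite /= subSS subn_gt0 ltn_neqAle -ltnS ltn_ord andbT -[d]/(val (@ord_max d)) (inj_eq val_inj).
by rewrite /= rev_ordK -memvE usU.
Qed.

Lemma flag_free (K : fieldType) (V : vectType K) (F : nat -> {vspace V})
    (w : nat -> V) (n : nat) :
  (forall m, (m < n)%N -> [/\ (F m <= F m.+1)%VS, w m \in F m.+1 & w m \notin F m]) ->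
  (<<mkseq w n>> <= F n)%VS /\ free (mkseq w n).
Proof.
elim: n => [|n IHn] Fw; first by rewrite span_nil sub0v nil_free.
have [FS wS wN] := Fw n (leqnn _).
have [sub fr] := IHn (fun m mn => Fw m (ltnW mn)).
split.
  apply/span_subvP=> x; rewrite mkseqS mem_rcons inE => /orP[/eqP -> //|xw].
  by apply: subvP FS _ _; apply: subvP sub _ _; apply: memv_span.
have /perm_free -> : perm_eq (mkseq w n.+1) (w n :: mkseq w n).
  by rewrite mkseqS perm_rcons.
by rewrite free_cons fr andbT; apply: contra wN; apply/subvP.
Qed.

Lemma newton_free (K : fieldType) (V : vectType K) (A B : 'End(V)) (d : nat)
    (U Us : 'I_d.+1 -> {vspace V}) (theta thetas : 'I_d.+1 -> K) (n : nat) (v : V) :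
  td_system A B U Us theta thetas -> v \in Us ord0 -> v != 0 -> (n <= d.+1)%N ->
  let s := mkseq (fun m => newton_op A theta m v) n in
  (<<s>> <= head_sum Us n)%VS /\ free s.
Proof.
move=> sys vU vn0 nd; apply: flag_free => m mn; split.
- exact: head_sumS.
- exact: newton_head sys vU.
- by apply: newton_notin_head sys vU vn0 _; rewrite -ltnS (leq_trans mn).
Qed.

(** An [A]-invariant [T] containing [v] contains the free family of all [P_m v]. Keeping [T]
    arbitrary allows the bound to be used on the same [T] for the reversed flag, with another
    starting vector. *)
Lemma dim_head_cap (K : fieldType) (V : vectType K) (A B : 'End(V)) (d : nat)
    (U Us : 'I_d.+1 -> {vspace V}) (theta thetas : 'I_d.+1 -> K)
    (T : {vspace V}) (n : nat) (v : V) :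
  td_system A B U Us theta thetas -> v \in Us ord0 -> v != 0 ->
  (A @: T <= T)%VS -> v \in T -> (n <= d.+1)%N -> (n <= \dim (head_sum Us n :&: T))%N.
Proof.
move=> sys vU vn0 AT vT nd; have [sub fr] := newton_free sys vU vn0 nd.
move: fr; rewrite /free size_mkseq => /eqP {1}<-; apply: dimvS.
rewrite subv_cap sub; apply/span_subvP=> _ /mapP [m _ ->].
elim: m => [|m IHm]; first by rewrite id_lfunE.
rewrite newton_opS; apply: rpredB; last exact: rpredZ.
by apply: subvP AT _ _; apply: memv_img.
Qed.

(** The [d.+1] dimensions are positive and add up to [d.+1], which leaves no room for a larger
    one. *)
Lemma eigensystem_dim1 (K : fieldType) (V : vectType K) (A : 'End(V)) (d : nat)
    (U : 'I_d.+1 -> {vspace V}) (theta : 'I_d.+1 -> K) (i : 'I_d.+1) :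
  eigensystem A U theta -> \dim (fullv : {vspace V}) = d.+1 -> \dim (U i) = 1%N.
Proof.
move=> sysU; have [_ _ Un0 <-] := sysU.
rewrite (directvP (eigensystem_directv sysU)) /= => dimE.
have pos j : (0 < \dim (U j))%N by rewrite lt0n dimv_eq0.
apply/eqP; rewrite eqn_leq pos andbT -(leq_add2r d) add1n -dimE (bigD1 i) //= leq_add2l.
apply: (@leq_trans (\sum_(j < d.+1 | j != i) 1)); last exact: leq_sum.
by rewrite sum1_card cardC1 card_ord.
Qed.

(** * The algebra [D] as the span of the Newton polynomials *)

Lemma memv_span_mkseq (K : fieldType) (V : vectType K) (f : nat -> V) (n m : nat) :
  (m < n)%N -> f m \in <<mkseq f n>>%VS.
Proof. by move=> mn; apply: memv_span; apply: map_f; rewrite mem_iota. Qed.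

Lemma mem_span_mkseq (K : fieldType) (V : vectType K) (f : nat -> V) (n : nat) (v : V) :
  v \in <<mkseq f n>>%VS -> exists c : 'I_n -> K, v = \sum_i c i *: f i.
Proof.
have sz : size (mkseq f n) == n by rewrite size_mkseq.
move=> /(@coord_span _ _ _ (Tuple sz)) ->.
by eexists; apply: eq_bigr => i _; rewrite /= nth_mkseq.
Qed.

Lemma free_mkseq (K : fieldType) (V : vectType K) (f : nat -> V) (n : nat) (c : 'I_n -> K) :
  free (mkseq f n) -> \sum_i c i *: f i = 0 -> forall i, c i = 0.
Proof.
have sz : size (mkseq f n) == n by rewrite size_mkseq.
move=> /(@freeP _ _ _ (Tuple sz)) fr c0; apply: fr; rewrite -[RHS]c0.
by apply: eq_bigr => i _; rewrite /= nth_mkseq.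
Qed.

(** Used twice: it shows that [newton_span] is closed under products and, with [Y] the identity,
    that each [P_m] lies in every subalgebra containing [A]. *)
Lemma newton_comp_mem (K : fieldType) (V : vectType K) (A : 'End(V)) (d : nat)
    (theta : 'I_d.+1 -> K) (S : {vspace 'End(V)}) (Y : 'End(V)) (m : nat) :
  (forall Z, Z \in S -> (A \o Z)%VF \in S) -> Y \in S ->
  (newton_op A theta m \o Y)%VF \in S.
Proof.
move=> AS YS; elim: m => [|m IHm]; first by rewrite comp_lfun1l.
have -> : (newton_op A theta m.+1 \o Y =
    A \o (newton_op A theta m \o Y) - theta (inord m) *: (newton_op A theta m \o Y))%VF.
  by apply/lfunP=> w; rewrite add_lfunE opp_lfunE scale_lfunE !comp_lfunE newton_opS.
by apply: rpredB; [apply: AS | apply: rpredZ].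
Qed.

Definition newton_span (K : fieldType) (V : vectType K) (A : 'End(V)) (d : nat)
    (theta : 'I_d.+1 -> K) : {vspace 'End(V)} :=
  <<mkseq (newton_op A theta) d.+1>>%VS.

(** The recurrence gives [A P_i = P_(i+1) + theta_i P_i]; for [i = d] the first term leaves the list
    of generators but is zero by [newton_op_full]. *)
Lemma newton_span_comp (K : fieldType) (V : vectType K) (A : 'End(V)) (d : nat)
    (U : 'I_d.+1 -> {vspace V}) (theta : 'I_d.+1 -> K) (Y : 'End(V)) :
  eigensystem A U theta -> Y \in newton_span A theta ->
  (A \o Y)%VF \in newton_span A theta.
Proof.
move=> sysU /mem_span_mkseq [c ->].
rewrite (big_morph _ (comp_lfunDr A) (comp_lfun0r _ A)); apply: rpred_sum => i _.
rewrite -comp_lfunZr; apply: rpredZ.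
have -> : (A \o newton_op A theta i = newton_op A theta i.+1 + theta (inord i) *: newton_op A theta i)%VF.
  by apply/lfunP=> w; rewrite comp_lfunE add_lfunE scale_lfunE newton_opS subrK.
have Nmem m : (m <= d)%N -> newton_op A theta m \in newton_span A theta.
  by move=> md; apply: memv_span_mkseq.
apply: rpredD; last by apply: rpredZ; apply: Nmem; rewrite -ltnS.
have := ltn_ord i; rewrite ltnS leq_eqVlt => /orP[/eqP -> | /Nmem //].
by rewrite (newton_op_full sysU) mem0v.
Qed.

Lemma mem_newton_span (K : fieldType) (V : vectType K) (A : 'End(V)) (d : nat)
    (U : 'I_d.+1 -> {vspace V}) (theta : 'I_d.+1 -> K) (X : 'End(V)) :
  eigensystem A U theta -> in_generated_subalgebra A X -> X \in newton_span A theta.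
Proof.
move=> sysU; have AS Y := newton_span_comp (Y := Y) sysU.
have id_in : (\1%VF : 'End(V)) \in newton_span A theta.
  by rewrite -(newton_op0 A theta); apply: memv_span_mkseq.
apply; last by have := AS _ id_in; rewrite comp_lfun1r.
split=> // Y Z /mem_span_mkseq [c ->] ZS.
rewrite (big_morph (fun W => W \o Z)%VF (fun W W' => comp_lfunDl W W' Z) (comp_lfun0l _ Z)).
by apply: rpred_sum => i _; rewrite -comp_lfunZl; apply: rpredZ; apply: newton_comp_mem.
Qed.

Lemma newton_op_generated (K : fieldType) (V : vectType K) (A : 'End(V)) (d : nat)
    (theta : 'I_d.+1 -> K) (m : nat) :
  in_generated_subalgebra A (newton_op A theta m).
Proof.
move=> S [S1 Scomp] AS; rewrite -(comp_lfun1r (newton_op A theta m)).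
by apply: newton_comp_mem => // Z; apply: Scomp.
Qed.

(** * Dimension counts and the two implications *)

(** Inside [T] the head [head_sum Us i.+1] has dimension at least [i + 1] and the tail
    [tail_sum Us i] at least [d + 1 - i]. These add up to more than [d + 1], so the two meet, and
    they can only meet inside [Us i]. *)
Lemma eigenspace_meets_orbit (K : fieldType) (V : vectType K) (A B : 'End(V)) (d : nat)
    (U Us : 'I_d.+1 -> {vspace V}) (theta thetas : 'I_d.+1 -> K)
    (T : {vspace V}) (v v' : V) (i : 'I_d.+1) :
  td_system A B U Us theta thetas ->
  v \in Us ord0 -> v != 0 -> v \in T -> v' \in Us ord_max -> v' != 0 -> v' \in T ->
  (A @: T <= T)%VS -> (\dim T <= d.+1)%N -> (0 < \dim (Us i :&: T))%N.
Proof.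
move=> sys vU vn0 vT v'U v'n0 v'T AT dimT; have [_ sysUs _ _ _] := sys.
have dh := dim_head_cap sys vU vn0 AT vT (ltn_ord i : (i.+1 <= d.+1)%N).
have v'U' : v' \in (Us \o @rev_ord _) ord0.
  by rewrite /= (_ : rev_ord ord0 = ord_max) //; apply/val_inj; rewrite /= subn1.
(* In the reversed ordering of [Us], the vector [v'] plays the part of [v] and the tail becomes a
   head. *)
have := dim_head_cap (td_system_revr sys) v'U' v'n0 AT v'T (leq_subr i _).
rewrite -tail_sum_rev ?(ltnW (ltn_ord i)) // => dt.
have : (0 < \dim ((head_sum Us i.+1 :&: T) :&: (tail_sum Us i :&: T)))%N.
  have le_sum : (\dim ((head_sum Us i.+1 :&: T) + (tail_sum Us i :&: T)) <= d.+1)%N.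
    by apply: leq_trans dimT; apply: dimvS; rewrite subv_add !capvSr.
  have := dimv_sum_cap (head_sum Us i.+1 :&: T) (tail_sum Us i :&: T).
  by move: dh dt le_sum (ltn_ord i); lia.
move=> /leq_trans; apply; apply: dimvS; apply/subvP=> x.
rewrite !memv_cap => /andP[/andP[xh xT] /andP[xt _]]; rewrite xT andbT.
(* Once the component [u] of [x] in [Us i] is split off, the rest [h] lies in [head_sum Us i] and,
   being [x - u], also in [tail_sum Us i]. *)
move: xh; rewrite /head_sum (bigD1 i) //= => /memv_addP [u uU [h hh xE]].
suff h0 : h = 0 by rewrite xE h0 addr0.
apply: (head_tail_sum_cap (n := i) sysUs).
  apply: subvP hh; apply: sub_sumv_pred => j /andP[ji ne].
  by rewrite ltn_neqAle -ltnS ji andbT (inj_eq val_inj).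
rewrite -[h](addKr u) -xE addrC; apply: rpredB => //.
by rewrite memvE; apply: (sumv_sup i); rewrite -?memvE.
Qed.

(** The intersections [Us i :&: T] are independent and nonzero, so by dimension they exhaust [T]. As
    [B] acts on each by a scalar, [T] is also [B]-invariant, and irreducibility applies. *)
Lemma meets_all_eigenspaces_full (K : fieldType) (V : vectType K) (A B : 'End(V)) (d : nat)
    (U Us : 'I_d.+1 -> {vspace V}) (theta thetas : 'I_d.+1 -> K) (T : {vspace V}) :
  td_system A B U Us theta thetas -> (A @: T <= T)%VS -> (\dim T <= d.+1)%N ->
  (forall i, 0 < \dim (Us i :&: T))%N -> T = fullv.
Proof.
move=> [_ sysUs _ _ irr] AT dimT pos; have [_ UsE _ _] := sysUs.
pose T' := (\sum_i (Us i :&: T))%VS.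
have T'T : (T' <= T)%VS by apply/subv_sumP=> i _; apply: capvSr.
have dir : directv (\sum_i (Us i :&: T)).
  have /directv_sum_independent ind := eigensystem_directv sysUs.
  apply/directv_sum_independent=> us usU; apply: ind => i _.
  by have := usU i isT; rewrite memv_cap => /andP[].
have dimT' : (d.+1 <= \dim T')%N.
  rewrite (directvP dir) /= -[leqLHS]card_ord -sum1_card; exact: leq_sum.
have TE : T = T'.
  by apply/esym/eqP; rewrite eqEdim T'T (leq_trans dimT).
have BT : (B @: T <= T)%VS.
  rewrite {1}TE limg_sum; apply/subv_sumP=> i _; apply/subvP=> _ /memv_imgP [w + ->].
  by rewrite memv_cap UsE => /andP[/eqP -> wT]; apply: rpredZ.
case: (irr T AT BT) => // T0.
by have := pos ord0; rewrite T0 capv0 dimv0.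
Qed.

Lemma dim_of_intertwiner (K : fieldType) (V : vectType K) (A B : 'End(V)) (d : nat)
    (U Us : 'I_d.+1 -> {vspace V}) (theta thetas : 'I_d.+1 -> K) (X : 'End(V)) :
  td_system A B U Us theta thetas -> in_generated_subalgebra A X -> X != 0 ->
  (X @: Us ord0 <= Us ord_max)%VS -> \dim (fullv : {vspace V}) = d.+1.
Proof.
move=> sys genX Xn0 XU; have [sysU [_ _ /(_ ord0) Us0 _] _ _ _] := sys.
pose v := vpick (Us ord0).
have vU : v \in Us ord0 by apply: memv_pick.
have vn0 : v != 0 by rewrite vpick0.
pose T := <<mkseq (fun m => newton_op A theta m v) d.+1>>%VS.
have [_ fr] := newton_free sys vU vn0 (leqnn _).
have dimT : \dim T = d.+1 by move: fr; rewrite /free size_mkseq => /eqP.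
have evT Y : Y \in newton_span A theta -> Y v \in T.
  move=> /mem_span_mkseq [c ->]; rewrite sum_lfunE; apply: rpred_sum => i _.
  by rewrite scale_lfunE; apply: rpredZ; apply: (memv_span_mkseq (fun m => newton_op A theta m v)).
have AT : (A @: T <= T)%VS.
  rewrite limg_span; apply/span_subvP=> _ /mapP [_ /mapP [m md ->] ->].
  rewrite -comp_lfunE; apply: evT; apply: newton_span_comp sysU _.
  by apply: memv_span; apply: map_f.
have XS := mem_newton_span sysU genX.
rewrite -(@meets_all_eigenspaces_full _ _ _ _ _ _ _ _ _ _ sys AT) ?dimT // => i.
apply: (@eigenspace_meets_orbit _ _ _ _ _ _ _ _ _ T v (X v) i sys); rewrite ?dimT //.
- by have := @memv_span_mkseq _ _ (fun m => newton_op A theta m v) d.+1 0 isT; rewrite id_lfunE.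
- by apply: subvP XU _ _; apply: memv_img.
(* Independence of the [P_m v] makes evaluation at [v] injective on [newton_span], so [X v = 0]
   would give [X = 0]. *)
- have [c XE] := mem_span_mkseq XS; apply: contra Xn0 => /eqP Xv0.
  have c0 := free_mkseq fr (c := c); rewrite XE big1 // => i' _; rewrite c0 ?scale0r //.
  by rewrite -[RHS]Xv0 XE sum_lfunE; apply: eq_bigr => j _; rewrite scale_lfunE.
- exact: evT.
Qed.

(** The [d.+1] independent vectors [P_m v] now span [V], so some polynomial in [A] takes [v] to a
    chosen nonzero [u] in [Us ord_max]; since [Us ord0] is the line of [v], this suffices. *)
Lemma intertwiner_of_dim (K : fieldType) (V : vectType K) (A B : 'End(V)) (d : nat)
    (U Us : 'I_d.+1 -> {vspace V}) (theta thetas : 'I_d.+1 -> K) :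
  td_system A B U Us theta thetas -> \dim (fullv : {vspace V}) = d.+1 ->
  exists X, [/\ in_generated_subalgebra A X, X != 0 & (X @: Us ord0 <= Us ord_max)%VS].
Proof.
move=> sys dimV; have [_ sysUs _ _ _] := sys; have [_ _ Usn0 _] := sysUs.
pose v := vpick (Us ord0).
have vU : v \in Us ord0 by apply: memv_pick.
have vn0 : v != 0 by rewrite vpick0.
have Us0E : Us ord0 = <[v]>%VS.
  apply/esym/eqP; rewrite eqEdim -memvE vU (eigensystem_dim1 ord0 sysUs dimV).
  by rewrite dim_vline vn0.
pose u := vpick (Us ord_max).
have un0 : u != 0 by rewrite vpick0.
have [_ fr] := newton_free sys vU vn0 (leqnn _).
have : u \in <<mkseq (fun m => newton_op A theta m v) d.+1>>%VS.
  suff -> : <<mkseq (fun m => newton_op A theta m v) d.+1>>%VS = fullv by apply: memvf.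
  apply/eqP; rewrite eqEdim subvf dimV.
  by move: fr; rewrite /free size_mkseq => /eqP -> /=.
case/mem_span_mkseq=> c uE.
pose X := \sum_(i < d.+1) c i *: newton_op A theta i.
have Xv : X v = u by rewrite uE sum_lfunE; apply: eq_bigr => i _; rewrite scale_lfunE.
exists X; split.
- move=> S subS AS; apply: rpred_sum => i _; apply: rpredZ; exact: newton_op_generated.
- by apply: contraNneq un0 => X0; rewrite -Xv X0 zero_lfunE.
by rewrite Us0E limg_line Xv -memvE memv_pick.
Qed.

Theorem theorem5p2 (K : fieldType) (V : vectType K)
    (dimV : (0 < \dim (fullv : {vspace V}))%N)
    (A Astar : 'End(V)) (tdA : tridiagonal_pair A Astar)
    (d : nat) (U Ustar : 'I_d.+1 -> {vspace V})
    (ordU : standard_ordering A Astar U)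
    (ordUstar : standard_ordering Astar A Ustar) :
  (exists X : 'End(V),
     [/\ in_generated_subalgebra A X, X != 0
       & (X @: Ustar ord0 <= Ustar ord_max)%VS])
  <-> leonard_pair A Astar.
Proof.
have [[diagA diagAs] _ _ irr] := tdA.
have [[oU triAs] [oUs triA]] := (ordU, ordUstar).
have [theta sysU] := eigensystem_of_ordering diagA oU.
have [thetas sysUs] := eigensystem_of_ordering diagAs oUs.
have sys : td_system A Astar U Ustar theta thetas by split.
split=> [[X [genX Xn0 XU]] | [_ dimU _]].
  have dimE := dim_of_intertwiner sys genX Xn0 XU.
  split=> // W.
    by case: oU => _ UE /UE [i ->]; apply: eigensystem_dim1 sysU dimE.
  by case: oUs => _ UE /UE [i ->]; apply: eigensystem_dim1 sysUs dimE.
(* [V] is the direct sum of the [d.+1] lines [U i], so its dimension is [d.+1]. *)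
apply: intertwiner_of_dim sys _; have [_ _ _ <-] := sysU.
rewrite (directvP (eigensystem_directv sysU)) /= -[RHS]card_ord -sum1_card.
by apply: eq_bigr => i _; apply: dimU; case: oU => _ UE; apply/UE; exists i.
Qed.
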